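(* Let $p$ be an odd prime, let $V=\mathbb{F}_p\oplus\mathbb{F}_p^*$ and let $U=\mathbb{F}_p^3$ with the standard orthogonal form $\beta(x,y)=\sum_{i=1}^3x_iy_i$. Let $x_0\in U$ be a nonzero isotropic vector ($\beta(x_0,x_0)=0$), and define $\psi\in L^2(U)$ by $$\psi(z)=\begin{cases}0 & \text{if }\beta(z,z)\neq0\text{ or }z=0,\\ \ell_{\beta(x_0,z)} & \text{if }\beta(z,z)=0\text{ and } z\notin\mathbb{F}_p\,x_0,\\ \ell_{2\lambda} & \text{if } z=\lambda x_0\text{ with }\lambda\in\mathbb{F}_p^\times.\end{cases}$$ Then $\mathrm{Sp}(V)$ acts trivially on $\psi$ via the representation $\mu_{U\otimes V}$ on $L^2(U\otimes\mathbb{F}_p^* )\simeq L^2(U)$; that is, $\mu_{U\otimes V}(S)\psi=\psi$ for all $S\in\mathrm{Sp}(V)$.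
   Context: Notation. For $\lambda\in\mathbb{F}_p^\times$, $\ell_\lambda=\left(\frac{\lambda}{p}\right)$ is the Legendre symbol. $\omega(\lambda)=e^{2\pi i\lambda/p}$ for $\lambda\in\mathbb{F}_p$. For a finite set $S$, $L^2(S)$ is the Hilbert space of complex functions on $S$, and $\delta_s$ is the indicator function of $s\in S$. The transpose of a linear map $A$ is $A^t$. A map $A:Y^*\to Y$ is symmetric if $A=A^t$; one writes $A(y,y')=y'(Ay)$. Oscillator representation. For a finite-dimensional $\mathbb{F}_p$-space $Y$, $Y\oplus Y^*$ carries the symplectic form $[x\oplus y,x'\oplus y']=y'(x)-y(x')$. The oscillator representation $\mu_{Y\oplus Y^*}$ of $\mathrm{Sp}(Y\oplus Y^* )$ on $L^2(Y^* )$ is the representation determined on generators by $\mu(N_A)\delta_y=\omega(2^{-1}A(y,y))\,\delta_y$, $\ \mu(D_C)\delta_y=\ell_{\det C}\,\delta_{C^{-t}y}$, $\ \mu(J_B)\delta_y=\gamma(B)^{-1}\sum_{y'\in Y^*}\omega(B(y,y'))\,\delta_{y'}$, where $N_A=\begin{pmatrix}1&A\\0&1\end{pmatrix}$ ($A:Y^*\to Y$ symmetric), $D_C=\begin{pmatrix}C&0\\0&C^{-t}\end{pmatrix}$ ($C\in GL(Y)$), $J_B=\begin{pmatrix}0&B\\-B^{-1}&0\end{pmatrix}$ ($B:Y^*\to Y$ symmetric invertible), and $\gamma(B)=\sum_{y\in Y^*}\omega(-2^{-1}B(y,y))$. Here $X=\mathbb{F}_p$, $V=X\oplus X^*$, and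 $U\otimes V=(U\otimes X)\oplus(U\otimes X^* )$ is symplectic, the two summands being dual via $\langle u\otimes x,v\otimes y\rangle=\beta(u,v)y(x)$. Thus $\mu_{U\otimes V}$ acts on $L^2(U\otimes X^* )=L^2(U)$. For $S\in\mathrm{Sp}(V)$, $\mu_{U\otimes V}(S)$ means $\mu_{U\otimes V}(\mathrm{Id}_U\otimes S)$. *)

(* Defs.v *)
From mathcomp Require Import all_boot all_order all_algebra.
From mathcomp Require Import reals trigo.
From mathcomp Require Import complex.

Set Implicit Arguments.
Unset Strict Implicit.
Unset Printing Implicit Defensive.

Import Order.TTheory GRing.Theory Num.Theory.
Local Open Scope ring_scope.

(* A finite-dimensional space Y is taken to be F^n with its standard basis, and
   Y^* is F^n in the dual basis: the functional y in Y^* is x |-> y^T x.  A map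
   A : Y^* -> Y is then an n x n matrix, its transpose is A^T, and the bilinear
   form A(y, y') = y'(A y) is y'^T A y.  An element x (+) y of Y (+) Y^* is the
   column col_mx x y, and endomorphisms of Y (+) Y^* are 2 x 2 block matrices. *)
Section SymplecticSpace.
Variable F : fieldType.

Definition dot n (x y : 'cV[F]_n) : F := \sum_i x i 0 * y i 0.

Definition sympl_form n (w w' : 'cV[F]_(n + n)) : F :=
  dot (dsubmx w') (usubmx w) - dot (dsubmx w) (usubmx w').

Definition in_Sp n (S : 'M[F]_(n + n)) : Prop :=
  forall w w', sympl_form (S *m w) (S *m w') = sympl_form w w'.

Definition bilin n (A : 'M[F]_n) (y y' : 'cV[F]_n) : F := dot y' (A *m y).

Definition symmetric n (A : 'M[F]_n) : Prop := A^T = A.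

Definition Nmat n (A : 'M[F]_n) : 'M[F]_(n + n) := block_mx 1%:M A 0 1%:M.

Definition Dmat n (C : 'M[F]_n) : 'M[F]_(n + n) :=
  block_mx C 0 0 (invmx C)^T.

Definition Jmat n (B : 'M[F]_n) : 'M[F]_(n + n) :=
  block_mx 0 B (- invmx B) 0.

(* U = F^m, X = F, V = X (+) X^* = F^(1 + 1).  U (x) X and U (x) X^* are both
   identified with U by u (x) x |-> x u; the pairing beta(u, v) y(x) between them
   becomes the dot product.  Lemmas sympl_form_tens and tens_idP below check
   these identifications. *)
Definition tens m (u : 'cV[F]_m) (v : 'cV[F]_(1 + 1)) : 'cV[F]_(m + m) :=
  col_mx (usubmx v 0 0 *: u) (dsubmx v 0 0 *: u).

Definition tens_id m (S : 'M[F]_(1 + 1)) : 'M[F]_(m + m) :=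
  block_mx (ulsubmx S 0 0)%:M (ursubmx S 0 0)%:M
           (dlsubmx S 0 0)%:M (drsubmx S 0 0)%:M.

Lemma dotZ m a b (u v : 'cV[F]_m) : dot (a *: u) (b *: v) = a * b * dot u v.
Proof.
by rewrite /dot mulr_sumr; apply: eq_bigr => i _; rewrite !mxE mulrACA.
Qed.

Lemma dotC m (u v : 'cV[F]_m) : dot u v = dot v u.
Proof. by apply: eq_bigr => i _; rewrite mulrC. Qed.

Lemma sympl_form_tens m (u u' : 'cV[F]_m) v v' :
  sympl_form (tens u v) (tens u' v') = dot u u' * sympl_form v v'.
Proof.
rewrite /sympl_form /tens !col_mxKu !col_mxKd !dotZ (dotC u' u) -mulrBl mulrC.
by rewrite /dot !big_ord1.
Qed.

Lemma tens_idP m (S : 'M[F]_(1 + 1)) (u : 'cV[F]_m) v :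
  tens_id m S *m tens u v = tens u (S *m v).
Proof.
have -> : S *m v = col_mx (ulsubmx S *m usubmx v + ursubmx S *m dsubmx v)
                          (dlsubmx S *m usubmx v + drsubmx S *m dsubmx v).
  by rewrite -mul_block_col submxK vsubmxK.
rewrite /tens col_mxKu col_mxKd /tens_id mul_block_col !mul_scalar_mx !scalerA.
by rewrite -!scalerDl !mxE !big_ord1 !mxE.
Qed.

End SymplecticSpace.

Section Oscillator.
Variables (R : realType) (p : nat).
Implicit Types (l a : 'F_p) (n : nat).

Definition legendre l : R[i] :=
  if l == 0 then 0 else if [exists a, a ^+ 2 == l] then 1 else -1.

Definition expi (t : R) : R[i] := Complex (cos t) (sin t).

(* (l : nat) is the representative of l in {0, ..., p - 1}. *)
Definition omega l : R[i] := expi (2 * pi * (l : nat)%:R / p%:R).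

Definition L2 (S : finType) := {ffun S -> R[i]^o}.

Definition delta (S : finType) (s : S) : L2 S := [ffun t => (t == s)%:R].

Definition gamma n (B : 'M['F_p]_n) : R[i] :=
  \sum_(y : 'cV['F_p]_n) omega (- (2^-1 * bilin B y y)).

(* The matrices Nmat, Dmat, Jmat generate Sp, so these conditions determine mu
   on Sp; its values on matrices outside Sp are unconstrained and irrelevant. *)
Record oscillator_rep n
    (mu : 'M['F_p]_(n + n) ->
          {linear L2 'cV['F_p]_n -> L2 'cV['F_p]_n}) : Prop := {
  osc_1 : forall f, mu 1%:M f = f;
  osc_M : forall S T, in_Sp S -> in_Sp T ->
    forall f, mu (S *m T) f = mu S (mu T f);
  osc_N : forall A, symmetric A ->
    forall y, mu (Nmat A) (delta y) = omega (2^-1 * bilin A y y) *: delta y;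
  osc_D : forall C, C \in unitmx ->
    forall y, mu (Dmat C) (delta y) =
      legendre (\det C) *: delta ((invmx C)^T *m y);
  osc_J : forall B, symmetric B -> B \in unitmx ->
    forall y, mu (Jmat B) (delta y) =
      (gamma B)^-1 *: \sum_(y' : 'cV['F_p]_n) omega (bilin B y y') *: delta y'
}.

(* When x0 != 0 the scalar l with z = l *: x0 is unique, so the pick is
   unambiguous. *)
Definition psi (x0 : 'cV['F_p]_3) : L2 'cV['F_p]_3 :=
  [ffun z =>
    if (dot z z != 0) || (z == 0) then 0
    else if [pick l | z == l *: x0] is Some l then legendre (2 * l)
    else legendre (dot x0 z)].

End Oscillator.

(* Main.v *)
Require Import Defs.
From mathcomp Require Import all_boot all_order all_algebra.
From mathcomp Require Import cyclic finfield ring.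
From mathcomp Require Import reals trigo complex.

Set Implicit Arguments.
Unset Strict Implicit.
Unset Printing Implicit Defensive.

Import Order.TTheory GRing.Theory Num.Theory.
Local Open Scope ring_scope.

(** A matrix of determinant 1 acting on V becomes, on U (x) V, a 2 x 2 matrix
    of scalar blocks, and by the Bruhat decomposition it is a product of matrices
    N_a, D_a and J_b with scalar blocks [scal_block_big_cell],
    [scal_block_borel].  So psi has to be fixed by these three kinds only.

    N_a multiplies delta_y by omega(a beta(y, y) / 2), which is 1 on the isotropic
    cone, where psi lives.  D_a rescales the cone, and psi(a y) = ell(a) psi(y)
    compensates the factor ell(a^3) = ell(a).

    J_b is a Fourier transform, and this is the substantial case.  Complete x0
    to a basis x0, f, h of U in which beta is the discriminant form of binary
    quadratics [isotropic_frame].  The points of the cone other than 0 are, each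
    exactly once, the multiples e x0 and e (s^2 x0 + s f + h) with e <> 0, and
    psi takes the value ell(2 e) there, whence [psi_cone]
      psi = sum_e ell(2 e) (delta_(e x0) + sum_s delta_(e (s^2 x0 + s f + h))).
    In the Fourier transform at z, the sum over e of ell(2 e) omega(b e k) is the
    Gauss sum g times ell(2 b) ell(k), so the transform is
      ell(2 b) g (ell(A) + sum_s ell(A s^2 + B s + C)),
    with A, B, C the products of z with x0, f, h.  The last factor is the sum of
    ell over the values of a binary quadratic form on the projective line: it
    vanishes when the discriminant B^2 - 4 A C, a multiple of beta(z, z), is
    nonzero, and otherwise it is p ell(A), or p ell(C) in case A = 0
    [sum_legendre_quad].  That is p psi(z), so psi is an
    eigenvector for the eigenvalue ell(2 b) g p.  Finally gamma is the cube of a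
    one-dimensional quadratic Gauss sum, (ell(- b / 2) g)^3, which by
    g^2 = ell(-1) p [gauss_sqr] equals ell(2 b) g p as well. *)

(** * The Legendre symbol and Gauss sums over F_p *)

Section GaussSums.
Variables (R : realType) (p : nat).
Hypotheses (p_prime : prime p) (p_odd : odd p).
Implicit Types (a b c d x y s : 'F_p).

Local Notation ell := (@legendre R p).
Local Notation om := (@omega R p).

Lemma two_neq0 : (2 : 'F_p) != 0.
Proof.
rewrite -(dvdn_pcharf (pchar_Fp p_prime)) dvdn_prime2 //.
by apply: contraL p_odd => /eqP->.
Qed.

Lemma legendre0 : ell 0 = 0.
Proof. by rewrite /legendre eqxx. Qed.

Lemma legendre_sqr x : x != 0 -> ell (x ^+ 2) = 1.
Proof.
move=> x0; rewrite /legendre sqrf_eq0 (negPf x0).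
by case: existsP => // -[]; exists x.
Qed.

Lemma fermat_Fp x : x != 0 -> x ^+ p.-1 = 1.
Proof.
move=> x0; apply: (mulfI x0); have := expf_card x; rewrite card_Fp // => xp.
by rewrite mulr1 -exprS prednK ?prime_gt0.
Qed.

Lemma primitive_root_Fp : {z : 'F_p | p.-1.-primitive_root z}.
Proof.
pose rs := [seq x <- enum 'F_p | x != 0].
have: has p.-1.-primitive_root rs.
  apply: has_prim_root.
  - by rewrite -subn1 subn_gt0 prime_gt1.
  - apply/allP => x; rewrite mem_filter => /andP[x0 _].
    by apply/unity_rootP/fermat_Fp.
  - by rewrite filter_uniq ?enum_uniq.
  rewrite size_filter -{1}(card_Fp p_prime) -(cardC1 (0 : 'F_p)) cardE.
  by rewrite -size_filter /enum_mem filter_predT.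
by move=> /hasP/sig2W[z _ zP]; exists z.
Qed.

(** The exponent p - 1 of the root is even, so being a square is the parity of
    the discrete logarithm; multiplicativity of the symbol follows. *)
Lemma legendre_prim_root z i :
  p.-1.-primitive_root z -> ell (z ^+ i) = (-1) ^+ i.
Proof.
move=> zP; have p1_gt0 := prim_order_gt0 zP.
have z0 : z != 0.
  apply/eqP => z0; move: (prim_expr_order zP).
  rewrite z0 expr0n -[_ == _]negbK -lt0n p1_gt0 => /eqP.
  by rewrite eq_sym oner_eq0.
rewrite /legendre expf_eq0 (negPf z0) andbF -signr_odd.
have p1_even : (2 %| p.-1)%N by rewrite dvdn2 -oddS prednK ?prime_gt0.
case: existsP => [[x /eqP xz]|nx]; last first.
  case odd_i: (odd i) => //; case: nx; exists (z ^+ i./2).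
  by rewrite -exprM muln2 halfK odd_i subn0.
have x0 : x != 0 by rewrite -(sqrf_eq0 x) xz expf_neq0.
have [j xj] := prim_rootP zP (fermat_Fp x0).
move: xz => /eqP; rewrite xj -exprM (eq_prim_root_expr zP) => /eqP ji.
have := congr1 (fun k => k %% 2)%N ji.
rewrite !modn_dvdm // !modn2 muln2 odd_double.
by case: (odd i).
Qed.

Lemma legendreM x y : ell (x * y) = ell x * ell y.
Proof.
have [z zP] := primitive_root_Fp.
have [->|x0] := eqVneq x 0; first by rewrite !(mul0r, legendre0).
have [->|y0] := eqVneq y 0; first by rewrite !(mulr0, legendre0).
have [[i ->] [j ->]] :=
  (prim_rootP zP (fermat_Fp x0), prim_rootP zP (fermat_Fp y0)).
by rewrite -exprD !(legendre_prim_root _ zP) exprD.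
Qed.

Lemma legendre_mul_self x : ell x * ell x = (x != 0)%:R.
Proof.
rewrite -legendreM -expr2; have [->|x0] := eqVneq x 0.
  by rewrite expr0n legendre0.
exact: legendre_sqr.
Qed.

Lemma legendre_neq0 x : x != 0 -> ell x != 0.
Proof.
move=> x0; apply/eqP => lx0; have /eqP := legendre_mul_self x.
by rewrite lx0 x0 mul0r eq_sym oner_eq0.
Qed.

Lemma sum_legendre : \sum_x ell x = 0.
Proof.
have [z zP] := primitive_root_Fp.
have lz : ell z = -1 by rewrite -[z]expr1 (legendre_prim_root _ zP) expr1.
have z0 : z != 0.
  apply/eqP => z0; move/eqP: lz.
  by rewrite z0 legendre0 eq_sym oppr_eq0 oner_eq0.
have : \sum_x ell x = - \sum_x ell x.
  rewrite {1}(reindex_inj (mulfI z0)) /= -mulN1r -lz mulr_sumr.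
  by apply: eq_bigr => x _; rewrite legendreM.
by move/eqP; rewrite -addr_eq0 -mulr2n mulrn_eq0 /= => /eqP.
Qed.

(** 1 + ell x is the number of square roots of x. *)
Lemma sum_sqr (f : 'F_p -> R[i]) :
  \sum_s f (s ^+ 2) = \sum_x (1 + ell x) * f x.
Proof.
transitivity (\sum_x \sum_(s | s ^+ 2 == x) f (s ^+ 2)).
  by rewrite (partition_big (fun s => s ^+ 2) predT).
apply: eq_bigr => x _.
under eq_bigr => s /eqP -> do [].
rewrite sumr_const -mulr_natl; congr (_ * _).
have [->|x0] := eqVneq x 0.
  rewrite legendre0 addr0 (eq_card (B := pred1 (0 : 'F_p))) ?card1 // => s.
  exact: (sqrf_eq0 s).
rewrite /legendre (negPf x0); case: existsP => [[r /eqP rx]|nr].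
  have r0 : r != 0 by rewrite -(sqrf_eq0 r) rx.
  rewrite (eq_card (B := pred2 r (- r))) => [|s]; last first.
    by rewrite -rx; exact: (eqf_sqr s r).
  have rNr : r != - r.
    by rewrite -addr_eq0 -mulr2n -mulr_natl mulf_neq0 ?two_neq0.
  by rewrite card2 rNr.
rewrite eq_card0 ?subrr // => s; apply/negP => sx.
by case: nr; exists s.
Qed.

Lemma expiD (t u : R) : expi (t + u) = expi t * expi u.
Proof.
by rewrite /expi cosD sinD /GRing.mul /=; congr Complex; rewrite addrC.
Qed.

Lemma expiMn (t : R) n : expi (t * n%:R) = expi t ^+ n.
Proof.
elim: n => [|n IHn]; first by rewrite mulr0 /expi cos0 sin0.
by rewrite -natr1 mulrDr mulr1 expiD IHn exprSr.
Qed.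

Lemma omegaE x : om x = expi (2 * pi / p%:R : R) ^+ x.
Proof. by rewrite /omega -expiMn mulrAC. Qed.

Lemma expi_order : expi (2 * pi / p%:R : R) ^+ p = 1.
Proof.
rewrite -expiMn divfK ?pnatr_eq0 -?lt0n ?prime_gt0 //.
by rewrite /expi mulr_natl cos2pi sin2pi.
Qed.

Lemma omegaD x y : om (x + y) = om x * om y.
Proof.
rewrite !omegaE -exprD.
have -> : (x + y : 'F_p) = ((x + y) %% p)%N :> nat.
  by congr (_ %% _)%N; exact: Fp_cast.
by rewrite expr_mod // expi_order.
Qed.

Lemma omega0 : om 0 = 1.
Proof. by rewrite omegaE. Qed.

(** Cosine is injective on [0, pi], which contains 2 pi / p because p > 2. *)
Lemma omega1_neq1 : om 1 != 1.
Proof.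
have p_gt2 : (2 < p)%N by rewrite odd_prime_gt2.
have p_gt0 : 0 < p%:R :> R by rewrite ltr0n prime_gt0.
rewrite omegaE expr1; apply/eqP => /(congr1 (@complex.Re R)) /=.
rewrite -[RHS]cos0 => /cos_inj.
rewrite !in_itv /= lexx pi_ge0 divr_ge0 ?mulr_ge0 ?pi_ge0 ?ler0n //=.
rewrite ler_pdivrMr // mulrC ler_wpM2l ?pi_ge0 ?ler_nat ?(ltnW p_gt2) //.
move=> /(_ isT isT)/eqP; rewrite mulf_eq0 mulf_eq0 invr_eq0.
by rewrite (gt_eqF p_gt0) (gt_eqF (pi_gt0 R)) pnatr_eq0.
Qed.

(** The sum of omega is unchanged by the shift x |-> 1 + x, which multiplies it
    by omega 1 <> 1. *)
Lemma sum_omega a : \sum_x om (a * x) = if a == 0 then p%:R else 0.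
Proof.
case: eqVneq => [->|a0].
  under eq_bigr => x _ do rewrite mul0r omega0.
  by rewrite sumr_const card_Fp.
have <- : \sum_x om x = \sum_x om (a * x) by rewrite (reindex_inj (mulfI a0)).
have : \sum_x om x = om 1 * \sum_x om x.
  rewrite {1}(reindex_inj (addrI 1)) /= mulr_sumr.
  by apply: eq_bigr => x _; rewrite omegaD.
move/eqP; rewrite -subr_eq0 -{1}[X in X - _]mul1r -mulrBl mulf_eq0 subr_eq0.
by rewrite eq_sym (negPf omega1_neq1) => /eqP.
Qed.

Definition gauss : R[i] := \sum_x ell x * om x.

Lemma gauss_twist a : \sum_x ell x * om (a * x) = ell a * gauss.
Proof.
have [->|a0] := eqVneq a 0.
  under eq_bigr => x _ do rewrite mul0r omega0 mulr1.
  by rewrite sum_legendre legendre0 mul0r.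
rewrite /gauss [in RHS](reindex_inj (mulfI a0)) mulr_sumr /=.
apply: eq_bigr => x _.
by rewrite legendreM !mulrA legendre_mul_self a0 mul1r.
Qed.

Lemma gauss_quad a : a != 0 -> \sum_s om (a * s ^+ 2) = ell a * gauss.
Proof.
move=> a0; rewrite (sum_sqr (fun x => om (a * x))) -gauss_twist.
under eq_bigr => x _ do rewrite mulrDl mul1r.
by rewrite big_split /= sum_omega (negPf a0) add0r.
Qed.

(** The sums of omega(y^2) and of omega(- x^2) have product p: writing
    y = x + u turns the exponent into 2 u x + u^2, and summing over x leaves
    u = 0 only.  By [gauss_quad] this product is also ell(-1) gauss^2. *)
Lemma gauss_sqr : gauss ^+ 2 = ell (-1) * p%:R.
Proof.
have N1 : (-1 : 'F_p) != 0 by rewrite oppr_eq0 oner_eq0.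
have l1 : ell 1 = 1 by rewrite -[1](expr1n _ 2) legendre_sqr ?oner_eq0.
have : (\sum_y om (1 * y ^+ 2)) * \sum_x om (-1 * x ^+ 2) = p%:R.
  rewrite mulr_sumr.
  transitivity (\sum_x \sum_u om (2 * u * x) * om (u ^+ 2)).
    apply: eq_bigr => x _; rewrite mulr_suml (reindex_inj (addrI x)) /=.
    by apply: eq_bigr => u _; rewrite -!omegaD; congr om; ring.
  rewrite exchange_big /= (bigD1 0) //= [X in _ + X]big1 => [|u u0].
    under eq_bigr => x _ do rewrite mulr0 mul0r expr0n omega0 mulr1.
    by rewrite sumr_const card_Fp // addr0.
  by rewrite -mulr_suml sum_omega mulf_eq0 (negPf two_neq0) (negPf u0) mul0r.
rewrite !gauss_quad ?oner_eq0 // l1 mul1r mulrCA -expr2 => <-.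
by rewrite mulrA legendre_mul_self N1 mul1r.
Qed.

Lemma gauss_neq0 : gauss != 0.
Proof.
rewrite -sqrf_eq0 gauss_sqr mulf_eq0 negb_or pnatr_eq0 -lt0n prime_gt0 //.
by rewrite legendre_neq0 // oppr_eq0 oner_eq0.
Qed.

(** Expanding ell(s^2 - d) * gauss by [gauss_twist] makes the sum over s a
    quadratic Gauss sum ell(x) * gauss, whose sign cancels the factor ell(x). *)
Lemma sum_legendre_sqrB d :
  \sum_s ell (s ^+ 2 - d) = if d == 0 then p%:R - 1 else -1.
Proof.
apply: (mulIf gauss_neq0); rewrite mulr_suml.
under eq_bigr => s _ do rewrite -gauss_twist.
rewrite exchange_big /=.
transitivity (\sum_x (x != 0)%:R * om (- d * x) * gauss).
  apply: eq_bigr => x _.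
  transitivity (ell x * om (- d * x) * \sum_s om (x * s ^+ 2)).
    rewrite mulr_sumr; apply: eq_bigr => s _.
    by rewrite -mulrA -omegaD; congr (_ * om _); ring.
  have [->|x0] := eqVneq x 0; first by rewrite legendre0 !mul0r.
  by rewrite gauss_quad // mul1r mulrAC mulrA legendre_mul_self x0 mul1r mulrC.
rewrite -mulr_suml; congr (_ * _).
have := sum_omega (- d); rewrite (bigD1 0) //= mulr0 omega0 oppr_eq0.
under [in X in _ -> X]eq_bigr => x _ do rewrite mulr_natl mulrb.
rewrite -big_mkcond /= => /(canRL (addKr _)) ->.
by case: ifP => _; rewrite ?addr0 // addrC.
Qed.

(** The left-hand side is the sum of the symbol over the values of the form
    a s^2 + b s t + c t^2 at the points (1 : 0) and (s : 1) of the projective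
    line, which is why the discriminant decides it also for a = 0.  For a <> 0
    completing the square reduces it to [sum_legendre_sqrB]. *)
Lemma sum_legendre_quad a b c :
  ell a + \sum_s ell (a * s ^+ 2 + b * s + c) =
  if b ^+ 2 == 4 * a * c then p%:R * ell (if a == 0 then c else a) else 0.
Proof.
have [-> | a0] := eqVneq a 0.
  rewrite legendre0 add0r mulr0 mul0r sqrf_eq0.
  have [-> | b0] := eqVneq b 0.
    under eq_bigr => s _ do rewrite !mul0r !add0r.
    by rewrite sumr_const card_Fp // mulr_natl.
  under eq_bigr => s _ do rewrite mul0r add0r.
  rewrite -[RHS]sum_legendre.
  by rewrite [RHS](reindex_inj (inj_comp (addIr c) (mulfI b0))).
have a2 : 2 * a != 0 by rewrite mulf_neq0 ?two_neq0.
pose d := (b ^+ 2 - 4 * a * c) / (2 * a) ^+ 2.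
rewrite (reindex_inj (addIr (- (b / (2 * a))))) /=.
have -> : \sum_s ell (a * (s - b / (2 * a)) ^+ 2 + b * (s - b / (2 * a)) + c)
    = ell a * \sum_s ell (s ^+ 2 - d).
  rewrite mulr_sumr; apply: eq_bigr => s _; rewrite -legendreM; congr ell.
  by rewrite /d; field; rewrite two_neq0 a0.
rewrite sum_legendre_sqrB /d mulf_eq0 invr_eq0 expf_eq0 (negPf a2).
rewrite orbF subr_eq0.
by case: ifP => _; ring.
Qed.

End GaussSums.

(** * Frames adapted to an isotropic vector *)

Lemma four_neq0 (F : fieldType) : (2 : F) != 0 -> (4 : F) != 0.
Proof.
have -> : (4 : F) = 2 * 2 by ring.
by move=> two0; rewrite mulf_neq0.
Qed.

Section IsotropicFrame.
Variable F : fieldType.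
Implicit Types x y z f h : 'cV[F]_3.

Lemma dotDl n (x y z : 'cV[F]_n) : dot (x + y) z = dot x z + dot y z.
Proof.
by rewrite /dot -big_split; apply: eq_bigr => i _; rewrite mxE mulrDl.
Qed.

Lemma dotZl n a (x y : 'cV[F]_n) : dot (a *: x) y = a * dot x y.
Proof. by rewrite -[y in LHS]scale1r dotZ mulr1. Qed.

Lemma dotDr n (x y z : 'cV[F]_n) : dot x (y + z) = dot x y + dot x z.
Proof. by rewrite dotC dotDl !(dotC x). Qed.

Lemma dotZr n a (x y : 'cV[F]_n) : dot x (a *: y) = a * dot x y.
Proof. by rewrite dotC dotZl dotC. Qed.

Lemma dot0r n (x : 'cV[F]_n) : dot x 0 = 0.
Proof. by rewrite -(scale0r (0 : 'cV_n)) dotZr mul0r. Qed.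

Lemma dot3 x y : dot x y = x 0 0 * y 0 0 + x 1 0 * y 1 0 + x 2 0 * y 2 0.
Proof.
rewrite /dot !big_ord_recl big_ord0 addr0 -!addrA.
by congr (_ * _ + (_ * _ + _ * _)); congr (_ _ 0); exact: val_inj.
Qed.

Lemma col3P x y : x 0 0 = y 0 0 -> x 1 0 = y 1 0 -> x 2 0 = y 2 0 -> x = y.
Proof.
move=> e0 e1 e2; apply/colP => -[[|[|[|//]]] lti].
- by have -> : Ordinal lti = 0 by exact: val_inj.
- by have -> : Ordinal lti = 1 by exact: val_inj.
- by have -> : Ordinal lti = 2 by exact: val_inj.
Qed.

Definition cross x y : 'cV[F]_3 :=
  \col_i nth 0 [:: x 1 0 * y 2 0 - x 2 0 * y 1 0;
                   x 2 0 * y 0 0 - x 0 0 * y 2 0;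
                   x 0 0 * y 1 0 - x 1 0 * y 0 0] i.

Lemma dot_cross x y :
  [/\ dot x (cross x y) = 0, dot y (cross x y) = 0
    & dot (cross x y) (cross x y) = dot x x * dot y y - dot x y ^+ 2].
Proof. by rewrite !dot3 !mxE /=; split; ring. Qed.

(** This expands z in the basis x, cross x y, y by Cramer's rule; the
    coefficients of x and y come from the double cross product formula. *)
Lemma cross_decomposition x y z :
  dot (cross x y) (cross x y) *: z =
  (dot y y * dot x z - dot x y * dot y z) *: x
  + dot (cross x y) z *: cross x y
  + (dot x x * dot y z - dot x y * dot x z) *: y.
Proof. by apply: col3P; rewrite !mxE !dot3 !mxE /=; ring. Qed.

(** The Gram matrix makes s^2 x + s t f + t^2 h isotropic for all s, t.  Its
    determinant is 16, a square, as it must be for a basis of F^3 with the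
    standard form; this is what ties the class of dot x h to that of 2. *)
Record isotropic_frame x f h : Prop := {
  frame_xx : dot x x = 0;
  frame_xf : dot x f = 0;
  frame_xh : dot x h = 2;
  frame_ff : dot f f = - 4;
  frame_fh : dot f h = 0;
  frame_hh : dot h h = 0;
  frame_span z :
    z = (dot h z / 2) *: x + (- (dot f z / 4)) *: f + (dot x z / 2) *: h
}.

(** A vector w with dot x w = 2 is made isotropic by subtracting a multiple of x;
    the cross product of x with the result supplies the middle vector, with square
    0 * 0 - 2^2 = - 4. *)
Lemma isotropic_frame_exists x :
  (2 : F) != 0 -> x != 0 -> dot x x = 0 -> exists f h, isotropic_frame x f h.
Proof.
move=> two0 x0 xx.
have four0 := four_neq0 two0.
have [w xw] : exists w, dot x w = 2.
  have /cV0Pn[i xi] : x != 0 by [].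
  exists ((2 / x i 0) *: delta_mx i 0); rewrite dotZr /dot (bigD1 i) //=.
  rewrite big1 => [|j ji]; first by rewrite !mxE !eqxx mulr1 addr0 divfK.
  by rewrite mxE (negPf ji) mulr0.
have [h xh hh] : exists2 h, dot x h = 2 & dot h h = 0.
  have xh : dot x (w + (- (dot w w / 4)) *: x) = 2.
    by rewrite dotDr dotZr xx xw mulr0 addr0.
  exists (w + (- (dot w w / 4)) *: x) => //.
  by rewrite dotDl dotZl xh dotDr dotZr (dotC w x) xw; field; rewrite four0.
have [xf hf ff] := dot_cross x h.
have span := cross_decomposition x h.
have {}ff : dot (cross x h) (cross x h) = - 4 by rewrite ff xx xh; ring.
exists (cross x h), h; split=> //; first by rewrite dotC.
move=> z; have := span z; rewrite ff xx hh xh !mul0r !sub0r => e.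
apply: (scalerI (_ : - 4 != 0)); first by rewrite oppr_eq0.
rewrite e !scalerDr !scalerA; congr (_ *: _ + _ *: _ + _ *: _); field.
all: by rewrite ?two0 ?four0.
Qed.


Lemma frame_coordE x f h z a b c : (2 : F) != 0 -> isotropic_frame x f h ->
  (z == a *: x + b *: f + c *: h) =
  [&& dot h z == 2 * a, dot f z == - 4 * b & dot x z == 2 * c].
Proof.
move=> two0 [xx xf xh ff fh hh span].
have four0 := four_neq0 two0.
apply/eqP/and3P => [->|[/eqP hz /eqP fz /eqP xz]]; last first.
  rewrite [LHS]span hz fz xz; congr (_ *: _ + _ *: _ + _ *: _); field => //.
rewrite !dotDr !dotZr (dotC h x) (dotC f x) (dotC h f) xx xf xh ff fh hh.
by split; apply/eqP; ring.
Qed.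

Lemma frame_dot x f h z : (2 : F) != 0 -> isotropic_frame x f h ->
  4 * dot z z = 4 * dot x z * dot h z - dot f z ^+ 2.
Proof.
move=> two0 [xx xf xh ff fh hh span].
have four0 := four_neq0 two0.
rewrite {2}[z in dot z z]span !dotDr !dotZr !(dotC z); field.
by rewrite two0 four0.
Qed.

End IsotropicFrame.

(** * The function psi on the isotropic cone *)

Section ConeFunction.
Variables (R : realType) (p : nat).
Hypotheses (p_prime : prime p) (p_odd : odd p).
Variables (x f h : 'cV['F_p]_3).
Hypothesis frame : isotropic_frame x f h.

Local Notation ell := (@legendre R p).
Local Notation om := (@omega R p).

Let two0 : (2 : 'F_p) != 0 := two_neq0 p_prime p_odd.
Let four0 : (4 : 'F_p) != 0 := four_neq0 two0.

(** If z is isotropic then dot x z = 0 forces dot f z = 0, so z lies on the line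
    of x exactly when dot x z = 0, and then dot h z = 2 l for z = l x. *)
Lemma psi_coordE z :
  psi R x z = if dot f z ^+ 2 == 4 * dot x z * dot h z
              then ell (if dot x z == 0 then dot h z else dot x z) else 0.
Proof.
have zz : (dot z z != 0) = (dot f z ^+ 2 != 4 * dot x z * dot h z).
  rewrite -(inj_eq (mulfI four0)) (frame_dot z two0 frame) mulr0 subr_eq0.
  by rewrite eq_sym.
rewrite ffunE zz; case: ifP => /= [/orP[/negPf->//|/eqP->]|].
  by rewrite !dot0r eqxx legendre0 if_same.
move=> /norP[/negPn/eqP disc z0]; rewrite disc eqxx.
case: pickP => [l /eqP->|noline].
  by rewrite !dotZr (frame_xx frame) mulr0 eqxx (dotC h) (frame_xh frame) mulrC.
case: eqVneq => // xz0; have := noline (dot h z / 2).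
move/eqP: disc; rewrite xz0 mulr0 mul0r sqrf_eq0 => /eqP fz0.
by rewrite {1}(frame_span frame z) fz0 xz0 !mul0r oppr0 !scale0r !addr0 eqxx.
Qed.

Lemma sum_legendre_frame z :
  ell (dot x z)
    + \sum_s ell (dot x z * s ^+ 2 + dot f z * s + dot h z)
  = p%:R * psi R x z.
Proof.
by rewrite sum_legendre_quad // psi_coordE; case: ifP; rewrite ?mulr0.
Qed.

Definition conic s : 'cV['F_p]_3 := s ^+ 2 *: x + s *: f + h.

Lemma dot_conic z s :
  dot z (conic s) = dot x z * s ^+ 2 + dot f z * s + dot h z.
Proof. by rewrite /conic !dotDr !dotZr !(dotC z) ![_ * dot _ z]mulrC. Qed.

Lemma deltaE (T : finType) (s t : T) : delta R s t = (t == s)%:R.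
Proof. by rewrite ffunE. Qed.

(** The summands with e = 0 are killed by the symbol, and the others run over
    the nonzero points of the cone without repetition.  If dot x z <> 0 then
    z = e (s^2 x + s f + h) forces e = dot x z / 2 and
    s = - dot f z / (2 dot x z), and these do give z exactly when z is isotropic;
    if dot x z = 0 then only z = e x is possible. *)
Lemma psi_cone :
  psi R x = \sum_e ell (2 * e) *:
              (delta R (e *: x) + \sum_s delta R (e *: conic s)).
Proof.
apply/ffunP => z; rewrite psi_coordE sum_ffunE.
have pt e : (z == e *: x) = [&& dot h z == 2 * e, dot f z == 0 & dot x z == 0].
  have := frame_coordE z e 0 0 two0 frame.
  by rewrite !scale0r !addr0 !mulr0.
have ptc e s : (z == e *: conic s) =
    [&& dot h z == 2 * (e * s ^+ 2), dot f z == - 4 * (e * s)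
      & dot x z == 2 * e].
  by rewrite -(frame_coordE z _ _ _ two0 frame) /conic !scalerDr !scalerA.
transitivity (\sum_e ell (2 * e)
                * ((z == e *: x)%:R + \sum_s (z == e *: conic s)%:R)).
  have [xz0|xz0] := eqVneq (dot x z) 0.
    transitivity (\sum_e ell (2 * e) * (z == e *: x)%:R); last first.
      apply: eq_bigr => e _; have [->|e0] := eqVneq e 0.
        by rewrite mulr0 legendre0 !mul0r.
      rewrite [X in _ + X]big1 ?addr0 // => s _.
      by rewrite ptc xz0 [0 == _]eq_sym mulf_eq0 (negPf two0) (negPf e0) !andbF.
    rewrite xz0 mulr0 mul0r sqrf_eq0 (bigD1 (dot h z / 2)) //= big1 => [|e eN].
      have e2 : 2 * (dot h z / 2) = dot h z by rewrite mulrC divfK.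
      rewrite addr0 pt xz0 e2 !eqxx andbT /=.
      by case: eqP => _; rewrite ?mulr1 ?mulr0.
    rewrite pt; case: eqP => [hz|_]; last by rewrite mulr0.
    by case/eqP: eN; rewrite hz mulrC mulKf.
  pose e := dot x z / 2; pose s := - dot f z / (2 * dot x z).
  have e2 : 2 * e = dot x z by rewrite mulrC divfK.
  rewrite (bigD1 e) //= [X in _ = _ + X]big1 => [|e' e'N]; last first.
    rewrite pt (negPf xz0) !andbF add0r big1 ?mulr0 // => s' _.
    rewrite ptc; case: (dot x z =P _) => [xz|_]; last by rewrite !andbF.
    by case/eqP: e'N; rewrite /e xz mulrC mulKf.
  rewrite pt (negPf xz0) !andbF add0r addr0 (bigD1 s) //= big1 => [|s' s'N].
    rewrite e2 addr0 ptc e2 eqxx andbT.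
    have -> : dot f z == - 4 * (e * s).
      by apply/eqP; rewrite /e /s; field; rewrite two0 xz0.
    have -> : (dot h z == 2 * (e * s ^+ 2)) =
              (dot f z ^+ 2 == 4 * dot x z * dot h z).
      rewrite -(inj_eq (mulfI (mulf_neq0 four0 xz0))) eq_sym; congr (_ == _).
      by rewrite /e /s; field; rewrite two0 xz0.
    by case: eqP => _; rewrite ?mulr1 ?mulr0.
  rewrite ptc; case: (dot f z =P _) => [fz|_]; last by rewrite !(andbF, andFb).
  case/eqP: s'N; rewrite /s fz -e2; field.
  by rewrite two0 mulf_neq0 ?invr_eq0.
apply: eq_bigr => e _; rewrite [RHS]ffunE [in RHS]ffunE deltaE sum_ffunE.
by congr (_ * (_ + _)); apply: eq_bigr => s _; rewrite deltaE.
Qed.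

End ConeFunction.

(** * Bruhat decomposition for scalar blocks *)

Section ScalarBlocks.
Variables (F : fieldType) (n : nat).
Implicit Types a b c d : F.

Definition scal_block n a b c d : 'M[F]_(n + n) :=
  block_mx a%:M b%:M c%:M d%:M.

Lemma scal_block_mul a b c d a' b' c' d' :
  scal_block n a b c d *m scal_block n a' b' c' d' =
  scal_block n (a * a' + b * c') (a * b' + b * d')
               (c * a' + d * c') (c * b' + d * d').
Proof. by rewrite /scal_block mulmx_block -!scalar_mxM -!raddfD. Qed.

Lemma sympl_form_scal_block a b c d (w w' : 'cV[F]_(n + n)) :
  sympl_form (scal_block n a b c d *m w) (scal_block n a b c d *m w') =
  (a * d - b * c) * sympl_form w w'.
Proof.
rewrite -[w]vsubmxK -[w']vsubmxK /scal_block !mul_block_col !mul_scalar_mx.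
rewrite /sympl_form !col_mxKu !col_mxKd !dotDl !dotDr !dotZ.
rewrite (dotC (usubmx w') (usubmx w)) (dotC (dsubmx w') (dsubmx w)).
rewrite (dotC (usubmx w') (dsubmx w)) (dotC (usubmx w) (dsubmx w')); ring.
Qed.

Lemma scal_block_in_Sp a b c d :
  a * d - b * c = 1 -> in_Sp (scal_block n a b c d).
Proof. by move=> det1 w w'; rewrite sympl_form_scal_block det1 mul1r. Qed.

Lemma scal_blockN a : scal_block n 1 a 0 1 = Nmat a%:M.
Proof. by rewrite /scal_block /Nmat raddf0. Qed.

Lemma scal_blockD a : a != 0 -> scal_block n a 0 0 a^-1 = Dmat a%:M.
Proof.
by move=> a0; rewrite /scal_block /Dmat invmx_scalar tr_scalar_mx !raddf0.
Qed.

Lemma scal_blockJ b : scal_block n 0 b (- b^-1) 0 = Jmat b%:M.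
Proof. by rewrite /scal_block /Jmat invmx_scalar !raddf0 raddfN. Qed.

Lemma scal_block_big_cell a b c d : c != 0 -> a * d - b * c = 1 ->
  scal_block n a b c d =
  Nmat (a / c)%:M *m (Jmat (- c^-1)%:M *m Nmat (d / c)%:M).
Proof.
move=> c0 det1; rewrite -!scal_blockN -scal_blockJ !scal_block_mul.
have -> : b = (a * d - 1) / c by rewrite -det1; field.
by congr scal_block; field; rewrite ?oppr_eq0 ?oner_eq0 ?c0.
Qed.

Lemma scal_block_borel a b d : a * d = 1 ->
  scal_block n a b 0 d = Dmat a%:M *m Nmat (b / a)%:M.
Proof.
move=> ad; have a0 : a != 0.
  by apply: contra_eq_neq ad => ->; rewrite mul0r eq_sym oner_neq0.
rewrite -scal_blockD // -scal_blockN scal_block_mul.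
have -> : d = a^-1 by apply: (mulfI a0); rewrite ad divff.
by congr scal_block; field.
Qed.

End ScalarBlocks.

(** Evaluating the form on the two standard basis vectors of V gives the
    determinant condition. *)
Lemma tens_id_scal_block (F : fieldType) m (S : 'M[F]_(1 + 1)) : in_Sp S ->
  exists a b c d, a * d - b * c = 1 /\ tens_id m S = scal_block m a b c d.
Proof.
move=> S_Sp.
pose a := ulsubmx S 0 0; pose b := ursubmx S 0 0.
pose c := dlsubmx S 0 0; pose d := drsubmx S 0 0.
exists a, b, c, d; split=> //.
have SE : S = scal_block 1 a b c d by rewrite /scal_block -!mx11_scalar submxK.
have := S_Sp (col_mx 1 0) (col_mx 0 1).
rewrite SE sympl_form_scal_block /sympl_form !col_mxKu !col_mxKd.
by rewrite /dot !big_ord1 !mxE /= mulr1 mulr0 subr0 mulr1.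
Qed.

(** * Invariance of psi *)

Section Invariance.
Variables (R : realType) (p : nat).
Hypotheses (p_prime : prime p) (p_odd : odd p).

Local Notation ell := (@legendre R p).
Local Notation om := (@omega R p).

Let two0 : (2 : 'F_p) != 0 := two_neq0 p_prime p_odd.

Lemma bilin_scalar n (a : 'F_p) (y z : 'cV['F_p]_n) :
  bilin a%:M y z = a * dot y z.
Proof. by rewrite /bilin mul_scalar_mx dotZr dotC. Qed.

Lemma omega_sum (I : finType) (F : I -> 'F_p) :
  om (\sum_i F i) = \prod_i om (F i).
Proof.
exact: (big_morph om (omegaD R p_prime) (omega0 R p)).
Qed.

(** The form is diagonal, so gamma factors into n quadratic Gauss sums. *)
Lemma gamma_scalar n (b : 'F_p) : b != 0 ->
  gamma R (b%:M : 'M_n) = (ell (- (2^-1 * b)) * gauss R p) ^+ n.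
Proof.
move=> b0; have k0 : - (2^-1 * b) != 0 by rewrite oppr_eq0 mulf_neq0 ?invr_eq0.
rewrite -(gauss_quad R p_prime p_odd k0) -[n in RHS]card_ord -prodr_const.
rewrite bigA_distr_bigA /= /gamma.
rewrite (reindex (fun g : {ffun 'I_n -> 'F_p} => \col_i g i)) /=; last first.
  exists (fun y : 'cV_n => [ffun i => y i 0]) => y _.
    by apply/ffunP => i; rewrite ffunE mxE.
  by apply/colP => i; rewrite mxE ffunE.
apply: eq_bigr => g _; rewrite -omega_sum bilin_scalar /dot !mulr_sumr -sumrN.
congr om; apply: eq_bigr => i _; rewrite !mxE; ring.
Qed.

Variables (x : 'cV['F_p]_3).
Hypotheses (x_neq0 : x != 0) (x_isotropic : dot x x = 0).
Variable mu : 'M['F_p]_(3 + 3) -> {linear L2 R 'cV['F_p]_3 -> L2 R 'cV['F_p]_3}.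
Hypothesis mu_osc : oscillator_rep mu.

Lemma L2_scaleE (T : finType) (k : R[i]) (g : L2 R T) t : (k *: g) t = k * g t.
Proof. by rewrite ffunE. Qed.

Lemma delta_expansion (T : finType) (g : L2 R T) :
  g = \sum_y g y *: delta R y.
Proof.
apply/ffunP => z; rewrite sum_ffunE (bigD1 z) //= big1 => [|y yz].
  by rewrite L2_scaleE deltaE eqxx addr0 mulr1.
by rewrite L2_scaleE deltaE eq_sym (negPf yz) mulr0.
Qed.

Lemma psi_fixed_by_N a : mu (Nmat a%:M) (psi R x) = psi R x.
Proof.
rewrite {1}[psi R x]delta_expansion linear_sum [RHS]delta_expansion.
apply: eq_bigr => y _; rewrite linearZ /= (osc_N mu_osc);
  last exact: tr_scalar_mx.
rewrite bilin_scalar; have [-> | yy] := eqVneq (dot y y) 0.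
  by rewrite !mulr0 omega0 scale1r.
by rewrite ffunE yy /= !scale0r.
Qed.

Lemma psi_homogeneous c y : c != 0 -> psi R x (c *: y) = ell c * psi R x y.
Proof.
move=> c0; have [f [h frame]] := isotropic_frame_exists two0 x_neq0 x_isotropic.
rewrite !(psi_coordE R p_prime p_odd frame) !dotZr mulf_eq0 (negPf c0) /=.
have -> : ((c * dot f y) ^+ 2 == 4 * (c * dot x y) * (c * dot h y)) =
          (dot f y ^+ 2 == 4 * dot x y * dot h y).
  rewrite -[RHS](inj_eq (mulfI (expf_neq0 2 c0))); congr (_ == _); ring.
by case: ifP => _; rewrite ?mulr0 //; case: ifP; rewrite legendreM.
Qed.

Lemma psi_fixed_by_D c : c != 0 -> mu (Dmat c%:M) (psi R x) = psi R x.
Proof.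
move=> c0; rewrite {1}[psi R x]delta_expansion linear_sum [RHS]delta_expansion.
rewrite (reindex_inj (scalerI c0)) /=.
apply: eq_bigr => y _; rewrite linearZ /= (osc_D mu_osc); last first.
  by rewrite unitmxE det_scalar unitfE expf_neq0.
rewrite invmx_scalar tr_scalar_mx mul_scalar_mx scalerK // det_scalar.
rewrite psi_homogeneous // scalerA; congr (_ *: _).
transitivity ((ell c * ell c) ^+ 2 * psi R x y).
  by rewrite exprS expr2 !legendreM //; ring.
by rewrite legendre_mul_self // c0 expr1n mul1r.
Qed.

(** Both the eigenvalue of psi for the unnormalised Fourier transform and gamma
    equal ell(2 b) p gauss. *)
Lemma psi_fixed_by_J b : b != 0 -> mu (Jmat b%:M) (psi R x) = psi R x.
Proof.
move=> b0; have [f [h frame]] := isotropic_frame_exists two0 x_neq0 x_isotropic.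
(* With k = - b / 2: gamma is ell(k)^3 g^3 = ell(k) ell(-1) p g, and
   2 b = - 4 k, so ell(2 b) = ell(-1) ell(k). *)
have gammaE : gamma R (b%:M : 'M_3) = ell (2 * b) * p%:R * gauss R p.
  have k0 : - (2^-1 * b) != 0 by rewrite oppr_eq0 mulf_neq0 ?invr_eq0.
  have -> : ell (2 * b) = ell (-1) * ell (- (2^-1 * b)).
    rewrite -legendreM // -[LHS]mulr1 -(legendre_sqr R (invr_neq0 two0)).
    by rewrite -legendreM //; congr ell; field.
  transitivity (ell (- (2^-1 * b)) ^+ 2 * gauss R p ^+ 2
                * (ell (- (2^-1 * b)) * gauss R p)).
    by rewrite gamma_scalar //; ring.
  by rewrite gauss_sqr // expr2 legendre_mul_self // k0 mul1r; ring.
have gamma_neq0 : gamma R (b%:M : 'M_3) != 0.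
  rewrite gammaE !mulf_neq0 ?gauss_neq0 ?legendre_neq0 ?mulf_neq0 //.
  by rewrite pnatr_eq0 -lt0n prime_gt0.
have JE y z : mu (Jmat b%:M) (delta R y) z =
    (gamma R (b%:M : 'M_3))^-1 * om (b * dot z y).
  rewrite (osc_J mu_osc) ?unitmxE ?det_scalar ?unitfE ?expf_neq0 //; last first.
    exact: tr_scalar_mx.
  rewrite L2_scaleE sum_ffunE (bigD1 z) //= big1 => [|y' y'z].
    by rewrite addr0 L2_scaleE deltaE eqxx mulr1 bilin_scalar dotC.
  by rewrite L2_scaleE deltaE eq_sym (negPf y'z) mulr0.
have twist k :
    \sum_e ell (2 * e) * om (b * k * e) = ell (2 * b) * gauss R p * ell k.
  transitivity (ell 2 * \sum_e ell e * om (b * k * e)).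
    by rewrite mulr_sumr; apply: eq_bigr => e _; rewrite legendreM // mulrA.
  by rewrite gauss_twist // !legendreM //; ring.
apply/ffunP => z.
rewrite {1}(psi_cone R p_prime p_odd frame) linear_sum sum_ffunE.
transitivity (\sum_e (gamma R (b%:M : 'M_3))^-1 *
    (ell (2 * e) * om (b * dot x z * e)
     + \sum_s ell (2 * e)
         * om (b * (dot x z * s ^+ 2 + dot f z * s + dot h z) * e))).
  apply: eq_bigr => e _; rewrite linearZ linearD linear_sum /= L2_scaleE.
  rewrite ffunE sum_ffunE JE mulrDr mulrCA [RHS]mulrDr; congr (_ * (_ * _) + _).
    by congr om; rewrite dotZr (dotC z); ring.
  rewrite !mulr_sumr; apply: eq_bigr => s _; rewrite JE mulrCA.
  by congr (_ * (_ * om _)); rewrite dotZr dot_conic; ring.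
rewrite -mulr_sumr big_split /= exchange_big /= twist.
under eq_bigr => s _ do rewrite twist.
rewrite -mulr_sumr -mulrDr sum_legendre_frame //.
apply: (mulfI gamma_neq0); rewrite mulVKf // gammaE; ring.
Qed.

End Invariance.

Theorem proposition3p4 (R : realType) (p : nat) (p_prime : prime p)
    (p_odd : odd p) (x0 : 'cV['F_p]_3) (x0_neq0 : x0 != 0)
    (x0_isotropic : dot x0 x0 = 0)
    (mu : 'M['F_p]_(3 + 3) ->
          {linear L2 R 'cV['F_p]_3 -> L2 R 'cV['F_p]_3})
    (mu_osc : oscillator_rep mu)
    (S : 'M['F_p]_(1 + 1)) (S_Sp : in_Sp S) :
  mu (tens_id 3 S) (psi R x0) = psi R x0.
Proof.
have [a [b [c [d [det1 ->]]]]] := tens_id_scal_block 3 S_Sp.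
have N_Sp t : in_Sp (Nmat (t%:M : 'M['F_p]_3)).
  by rewrite -scal_blockN; apply: scal_block_in_Sp; ring.
have D_Sp t : t != 0 -> in_Sp (Dmat (t%:M : 'M['F_p]_3)).
  by move=> t0; rewrite -scal_blockD //; apply: scal_block_in_Sp; field.
have J_Sp t : t != 0 -> in_Sp (Jmat (t%:M : 'M['F_p]_3)).
  by move=> t0; rewrite -scal_blockJ //; apply: scal_block_in_Sp; field.
have psiN t : mu (Nmat t%:M) (psi R x0) = psi R x0 by exact: psi_fixed_by_N.
have [c0 | c0] := eqVneq c 0.
  have ad : a * d = 1 by rewrite -det1 c0 mulr0 subr0.
  have a0 : a != 0.
    by apply: contra_eq_neq ad => ->; rewrite mul0r eq_sym oner_neq0.
  rewrite c0 scal_block_borel // (osc_M mu_osc (D_Sp _ a0) (N_Sp _)) psiN.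
  exact: psi_fixed_by_D.
have c1 : - c^-1 != 0 by rewrite oppr_eq0 invr_eq0.
have JN_Sp : in_Sp (Jmat (- c^-1)%:M *m Nmat ((d / c)%:M : 'M_3)).
  by move=> w w'; rewrite -!mulmxA (J_Sp _ c1) N_Sp.
rewrite scal_block_big_cell // (osc_M mu_osc (N_Sp _) JN_Sp).
rewrite (osc_M mu_osc (J_Sp _ c1) (N_Sp _)) psiN.
by rewrite (psi_fixed_by_J p_prime p_odd x0_neq0 x0_isotropic mu_osc c1) psiN.
Qed.
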